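(* Let $p,q,r$ be integers with $p\ge r>0$ and $q>0$. Then: (1) if $[r]_{2q}=k$ and $[p]_q=0$, then $NC(p,q;r,q)=|q-k|+\gcd(k,q)$ and $NC(p,q;r,-q)=|r-q|+\gcd(k,q)$; (2) if $[r]_{2q}=0$ and $[p]_q\ne 0$, then $NC(p,q;r,q)=q+\gcd(q,p)$ and $NC(p,q;r,-q)=r-q+\gcd(q,p)$; (3) if $[p]_q=[r]_{2q}$, then $NC(p,q;r,q)=\gcd(r,2q)$ and $NC(p,q;r,-q)=r$.
   Context: For positive integers $p\ge r>0$ and integers $q,s$, the twisted torus link $T(p,q;r,s)$ is the closure of the braid on $p$ strands $(\sigma_1\sigma_2\cdots\sigma_{p-1})^q(\sigma_1\cdots\sigma_{r-1})^s$, where $\sigma_1,\dots,\sigma_{p-1}$ are the standard generators of the braid group on $p$ strands (an empty product is the trivial braid). $NC(p,q;r,s)$ denotes the number of components of the link $T(p,q;r,s)$. For an integer $x$ and a positive integer $m$, $[x]_m\in\{0,1,\dots,m-1\}$ denotes the residue of $x$ modulo $m$. By convention $\gcd(a,0)=|a|$. *)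

(* Defs.v *)
From HB Require Import structures.
From mathcomp Require Import all_boot all_order all_algebra.
From mathcomp Require Import finmap.
From mathcomp Require Import all_classical all_reals all_analysis.

Set Implicit Arguments.
Unset Strict Implicit.
Unset Printing Implicit Defensive.

Import Order.TTheory GRing.Theory Num.Theory.
Import numFieldNormedType.Exports.

Local Open Scope classical_set_scope.
Local Open Scope ring_scope.

(* A letter (i, b) stands for sigma_(i+1) if b is true and for its inverse
   otherwise: generators, like strand positions 0, ..., p-1, are numbered
   from 0. *)
Definition braid_word (p : nat) := seq ('I_p.-1 * bool).

Definition braid_inv (p : nat) (w : braid_word p) : braid_word p :=
  rev [seq (g.1, ~~ g.2) | g <- w].

Definition braid_exp (p : nat) (w : braid_word p) (m : int) : braid_word p :=
  match m with
  | Posz n => flatten (nseq n w)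
  | Negz n => flatten (nseq n.+1 (braid_inv w))
  end.

(* sigma_1 sigma_2 ... sigma_(m-1), a word on p strands when m <= p *)
Definition sigma_prod (p m : nat) : braid_word p :=
  [seq (i, true) | i : 'I_p.-1 <- enum 'I_p.-1 & (i < m.-1)%N].

Definition twisted_torus_braid (p : nat) (q : int) (r : nat) (s : int) :
    braid_word p :=
  braid_exp (sigma_prod p p) q ++ braid_exp (sigma_prod p r) s.

Section Closure.
Variable R : realType.

Definition point3 : Type := (R^o * R^o * R^o)%type.

Definition segment (a b : point3) : set point3 :=
  (fun t : R => (1 - t) *: a + t *: b) @` `[0, 1].

Fixpoint polyline (s : seq point3) : set point3 :=
  if s is a :: s' then
    if s' is b :: _ then segment a b `|` polyline s' else set0
  else set0.

Section Word.
Variable p : nat.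

Definition letter_end (g : 'I_p.-1 * bool) (j : nat) : nat :=
  if j == g.1 then g.1.+1 else if j == g.1.+1 then (g.1 : nat) else j.

(* In a positive letter the strand starting on the left passes over the other
   one.  The opposite convention gives the mirror image of the link. *)
Definition letter_height (g : 'I_p.-1 * bool) (j : nat) : R :=
  if j == g.1 then (if g.2 then 1 else -1)
  else if j == g.1.+1 then (if g.2 then -1 else 1) else 0.

(* The n-th letter of a word lives in the slab n <= y <= n + 1; the strand
   entering it at position j goes from (j, n, 0) to (j', n + 1, 0), and is
   pushed up or down (in the z direction) halfway. *)
Definition letter_strand (g : 'I_p.-1 * bool) (n j : nat) : set point3 :=
  let j' := letter_end g j in
  polyline
    [:: (j%:R, n%:R, 0);
        ((j%:R + j'%:R) / 2, n%:R + 1 / 2, letter_height g j);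
        (j'%:R, n%:R + 1, 0)].

(* The arc joining the top endpoint (j, l, 0) to the bottom endpoint (j, 0, 0)
   above the braid; it is nondegenerate even for the empty word. *)
Definition closing_arc (l j : nat) : set point3 :=
  polyline
    [:: (j%:R, l%:R, 0); (j%:R, l%:R + 1, 2); (j%:R, -1, 2); (j%:R, 0, 0)].

Definition braid_closure (w : braid_word p) : set point3 :=
  (\bigcup_(n in [set: 'I_(size w)]) \bigcup_(j in [set: 'I_p])
     letter_strand (tnth (in_tuple w) n) n j)
  `|` \bigcup_(j in [set: 'I_p]) closing_arc (size w) j.

End Word.

(* The default value 0, for infinitely many connected components, is never
   reached for a finite union of polylines. *)
Definition num_components (A : set point3) : nat :=
  #|` fset_set (connected_component A @` A)|%fset.

Definition twisted_torus_link (p : nat) (q : int) (r : nat) (s : int) :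
    set point3 :=
  braid_closure (twisted_torus_braid p q r s).

Definition NC (p : nat) (q : int) (r : nat) (s : int) : nat :=
  num_components (twisted_torus_link p q r s).

End Closure.

(* Main.v *)
(* The components of the closure of a braid on p strands correspond to the
   cycles of its permutation of {0, ..., p-1}: the strands and closing arcs
   belonging to one cycle form a connected set, and those of different cycles
   are disjoint compact sets.

   For T(p, q; r, s) the inverse of this permutation is G = A B, with A the
   rotation by q of {0, ..., p-1} and B the rotation by s of {0, ..., r-1}
   extended by the identity.  The number of cycles of G is found by taking first
   return maps.
   For s = -q and q <= r, G fixes q, ..., r-1 and rotates the other p - r + q
   points by q.  For r <= q, if q divides p then the return map of G on
   {0, ..., q-1} is B, and if p = r mod q then the return map on {0, ..., r-1}
   is the rotation by q + s.  For s = q and r > 2 q, the return map on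
   {2 q, ..., p-1} is again of the form G, with p - 2 q and r - 2 q in place of
   p and r; this reduces s = q to r <= 2 q, where, if q divides p and q <= r,
   the return map on {0, ..., r-1} fixes r - q points and rotates the other q
   points. *)

Require Import Defs.
From mathcomp Require Import all_boot all_order all_algebra.
From mathcomp Require Import all_classical all_reals all_analysis.
From mathcomp Require Import zify lra.

Set Implicit Arguments.
Unset Strict Implicit.
Unset Printing Implicit Defensive.

Import Order.TTheory GRing.Theory Num.Theory.
Import numFieldNormedType.Exports.

(** * Orbits of maps on {0, ..., p-1} *)

Ltac split_ifs :=
  repeat match goal with
  | |- context [if ?b then _ else _] =>
      lazymatch b with
      | context [if _ then _ else _] => fail
      | _ => case: (boolP b) => ?
      end
  end.

(** For a permutation of a finite set this says that x and y lie on one cycle. Using forward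
    iterates on both sides avoids inverse maps. *)
Definition joined (T : Type) (g : T -> T) (x y : T) : Prop :=
  exists n m, iter n g x = iter m g y.

Lemma joined_refl (T : Type) (g : T -> T) x : joined g x x.
Proof. by exists 0, 0. Qed.

Lemma joined_sym (T : Type) (g : T -> T) x y : joined g x y -> joined g y x.
Proof. by case=> n [m e]; exists m, n. Qed.

Lemma joined_trans (T : Type) (g : T -> T) y x z :
  joined g x y -> joined g y z -> joined g x z.
Proof.
move=> [n [m e]] [k [l e']]; exists (k + n), (m + l).
by rewrite iterD e -iterD addnC iterD e' -iterD.
Qed.

Lemma joined_step (T : Type) (g : T -> T) x : joined g (g x) x.
Proof. by exists 0, 1. Qed.

Lemma joined_homo (T U : Type) (P : T -> Prop) (g : T -> T) (h : U -> U)
    (f : T -> U) (x y : T) :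
  (forall z, P z -> P (g z)) ->
  (forall z, P z -> joined h (f (g z)) (f z)) ->
  P x -> P y -> joined g x y -> joined h (f x) (f y).
Proof.
move=> Pg Hf Px Py [n [m e]].
have it k z : P z -> P (iter k g z) /\ joined h (f (iter k g z)) (f z).
  move=> Pz; elim: k => [|k [IH1 IH2]] /=; first by split=> //; exact: joined_refl.
  by split; [exact: Pg | exact: joined_trans (Hf _ IH1) IH2].
have [_ hx] := it n x Px; have [_ hy] := it m y Py.
by apply: joined_trans (joined_sym hx) _; rewrite e.
Qed.

(** [L] numbers the classes of [joined g] on {0, ..., p-1} by 0, ..., c-1, so c is the number of
    cycles when g permutes that set. *)
Definition counts (g : nat -> nat) (p c : nat) : Prop :=
  exists L : nat -> nat,
    [/\ forall x, x < p -> L x < c,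
        forall i, i < c -> exists2 x, x < p & L x = i
      & forall x y, x < p -> y < p -> (L x = L y <-> joined g x y)].

(* In the applications [iota] embeds a set met by every orbit of [g], [h] is the
   first return map to it, and [rho] sends a point to its first entry there. *)
Lemma counts_transfer (g h : nat -> nat) (p n c : nat) (rho iota : nat -> nat) :
  (forall x, x < p -> g x < p) -> (forall y, y < n -> h y < n) ->
  (forall x, x < p -> rho x < n) -> (forall y, y < n -> iota y < p) ->
  (forall x, x < p -> rho (g x) = rho x \/ rho (g x) = h (rho x)) ->
  (forall y, y < n -> rho (g (iota y)) = h y) ->
  (forall y, y < n -> rho (iota y) = y) ->
  (forall x, x < p -> joined g (iota (rho x)) x) ->
  counts h n c -> counts g p c.
Proof.
move=> gp hn rn ip rg rgi ri ir [L [Lc Ls Le]].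
exists (L \o rho); split=> [x xp|i ic|x y xp yp] /=.
- by apply/Lc/rn.
- by have [y yn <-] := Ls i ic; exists (iota y); [exact: ip | rewrite ri].
have xn := rn _ xp; have yn := rn _ yp.
rewrite Le //; split=> [j|j].
  apply: joined_trans (joined_sym (ir _ xp)) _; apply: joined_trans (ir _ yp).
  apply: (joined_homo (P := fun z => z < n) hn _ _ _ j) => // z zn.
  rewrite -rgi //; apply: joined_trans (ir _ (gp _ (ip _ zn))) _.
  exact: joined_step.
apply: (joined_homo (P := fun z => z < p) gp _ _ _ j) => // z zp.
by case: (rg z zp) => ->; [exact: joined_refl | exact: joined_step].
Qed.

Lemma counts_conj (g h : nat -> nat) (p c : nat) (rho iota : nat -> nat) :
  (forall x, x < p -> g x < p) ->
  (forall x, x < p -> rho x < p) -> (forall y, y < p -> iota y < p) ->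
  (forall x, x < p -> rho (g x) = h (rho x)) ->
  (forall y, y < p -> rho (iota y) = y) ->
  (forall x, x < p -> iota (rho x) = x) ->
  counts h p c -> counts g p c.
Proof.
move=> gp rp ip rg ri ir; apply: (counts_transfer (rho := rho) (iota := iota)) => //.
- by move=> y yp; rewrite -(ri y yp) -rg; [exact/rp/gp/ip | exact: ip].
- by move=> x /rg; right.
- by move=> y yp; rewrite rg ?ri //; exact: ip.
- by move=> x xp; rewrite ir //; exact: joined_refl.
Qed.

(** A step of one map is a step of the other read backwards, so mutually inverse maps have the same
    orbits. *)
Lemma counts_inv (g h : nat -> nat) (p c : nat) :
  (forall x, x < p -> g x < p) -> (forall x, x < p -> h x < p) ->
  (forall x, x < p -> h (g x) = x) ->
  (forall x, x < p -> g (h x) = x) ->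
  counts h p c -> counts g p c.
Proof.
move=> gp hp hg gh [L [Lc Ls Le]]; exists L; split=> // x y xp yp.
rewrite Le //; split=> j.
  apply: (joined_homo (P := fun z => z < p) (f := id) hp _ _ _ j) => // z zp.
  by apply: joined_sym; rewrite -{1}(gh _ zp); exact: joined_step.
apply: (joined_homo (P := fun z => z < p) (f := id) gp _ _ _ j) => // z zp.
by apply: joined_sym; rewrite -{1}(hg _ zp); exact: joined_step.
Qed.

(** * Rotations of an initial segment *)

Definition rot_on (m s x : nat) : nat := if x < m then (x + s) %% m else x.

Lemma rot_on_lt m s x : x + s < m -> rot_on m s x = x + s.
Proof. by move=> h; rewrite /rot_on ifT ?modn_small //; lia. Qed.

Lemma rot_on_wrap m s x : x < m -> m <= x + s -> x + s < m + m ->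
  rot_on m s x = x + s - m.
Proof.
move=> h1 h2 h3; rewrite /rot_on h1 -{1}(subnK h2) modnDr modn_small //; lia.
Qed.

Lemma rot_on_out m s x : m <= x -> rot_on m s x = x.
Proof. by move=> h; rewrite /rot_on ltnNge h. Qed.

Lemma rot_on_ltn m s p x : m <= p -> x < p -> rot_on m s x < p.
Proof.
rewrite /rot_on => mp xp; case: ifP => // xm.
by apply: leq_trans mp; rewrite ltn_mod; lia.
Qed.

Lemma rot_on_inv m s t x : m %| s + t -> rot_on m s (rot_on m t x) = x.
Proof.
move=> d; rewrite {2}/rot_on; case: (ltnP x m) => xm; last exact: rot_on_out.
rewrite /rot_on ltn_mod (leq_ltn_trans _ xm) // modnDml -addnA (addnC t).
by rewrite -modnDmr (eqP d) addn0 modn_small.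
Qed.

Lemma rot_on_ltm m s x : x < m -> rot_on m s x = (x + s) %% m.
Proof. by rewrite /rot_on => ->. Qed.

Lemma iter_rot_on m s n x : iter n (rot_on m s) x = rot_on m (n * s) x.
Proof.
elim: n => [|n IH] /=; first by rewrite /rot_on addn0; case: ifP => // /modn_small.
rewrite IH {2}/rot_on; case: (ltnP x m) => xm; last by rewrite !rot_on_out.
rewrite /rot_on xm ltn_mod (leq_ltn_trans _ xm) // modnDml; congr (_ %% _); lia.
Qed.

(** On {0, ..., m-1} the orbits are the residue classes modulo gcd(m, s): each step preserves the
    residue, and Bezout's identity connects a whole class. The other p - m points are fixed. *)
Lemma counts_rot_on m s p : 0 < m -> m <= p ->
  counts (rot_on m s) p (gcdn m s + (p - m)).
Proof.
move=> m0 mp; set d := gcdn m s.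
have d0 : 0 < d by rewrite gcdn_gt0 m0.
have dm : d <= m by exact/dvdn_leq/dvdn_gcdl.
have jmod x : x < m -> joined (rot_on m s) (x %% d) x.
  move=> xm.
  case: (egcdnP s m0) => a b e _; rewrite /=.
  have bez : (b * s) + d = a * m by rewrite e.
  (* going [x %/ d * b] steps forward from x subtracts x %/ d * d *)
  exists 0, (x %/ d * b); rewrite /= iter_rot_on rot_on_ltm //.
  have -> : x + x %/ d * b * s = x %/ d * a * m + x %% d.
    by rewrite {1}(divn_eq x d) -!mulnA -bez mulnDr addnAC (addnC (_ * d)).
  by rewrite modnMDl [in RHS]modn_small //; apply: leq_trans dm; rewrite ltn_mod.
exists (fun x => if x < m then x %% d else d + (x - m)); split.
- move=> x xp; case: (ltnP x m) => xm; last lia.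
  by apply: leq_trans (leq_addr _ _); rewrite ltn_mod.
- move=> i ic; case: (ltnP i d) => id.
    by exists i; [lia | rewrite ifT ?modn_small //; lia].
  by exists (m + (i - d)); [lia | rewrite ifF; lia].
move=> x y xp yp; split.
  case: (ltnP x m) => xm; case: (ltnP y m) => ym.
  - move=> e; apply: joined_trans (joined_sym (jmod x xm)) _.
    by rewrite e; exact: jmod.
  - by have := ltn_pmod x d0; lia.
  - by have := ltn_pmod y d0; lia.
  - by move=> e; rewrite (_ : x = y); [exact: joined_refl | lia].
case=> n [k]; rewrite !iter_rot_on.
case: (ltnP x m) => xm; case: (ltnP y m) => ym.
- rewrite !rot_on_ltm // => /(congr1 (modn^~ d)).
  rewrite !modn_dvdm ?dvdn_gcdl // -!(modnDmr _ (_ * s)).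
  by do 2!rewrite (eqP (dvdn_mull _ (dvdn_gcdr _ _))) ?addn0.
- rewrite (rot_on_out _ ym) => e; have := rot_on_ltn (n * s) (leqnn m) xm; lia.
- rewrite (rot_on_out _ xm) => e; have := rot_on_ltn (k * s) (leqnn m) ym; lia.
- by rewrite !rot_on_out // => ->.
Qed.

(** * First return maps of a composite of two rotations *)

Definition twist (p q r s x : nat) : nat := rot_on p q (rot_on r s x).

Lemma twist_ltn p q r s x : r <= p -> x < p -> twist p q r s x < p.
Proof. by move=> rp xp; apply/rot_on_ltn/rot_on_ltn. Qed.

(** The condition on s means s = -q mod r; it also covers s = q with r = 2 q. On q, ..., r-1 the two
    rotations cancel. Moving these points to the end by [rho] turns the map into the rotation by q
    of the other p - r + q points. *)
Lemma counts_twist_opp p q r s : r <= p -> 0 < q -> q <= r -> r %| s + q ->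
  counts (twist p q r s) p (gcdn (p - r + q) q + (r - q)).
Proof.
move=> rp q0 qr rsq.
rewrite (_ : r - q = p - (p - r + q)); last lia.
pose t := fun x => if x < q then x + (r - q) else if x < r then x - q else x.
have tE x : rot_on r s x = t x.
  (* Rotation by s undoes rotation by q on {0, ..., r-1}, so it is enough that rotation by q sends
     [t x] to x. *)
  rewrite -[RHS](@rot_on_inv r s q) //; congr rot_on; rewrite /t.
  case: ltnP => xq; last case: ltnP => xr.
  - by rewrite rot_on_wrap; lia.
  - by rewrite rot_on_lt; lia.
  - by rewrite rot_on_out.
pose rho x := if x < q then x else if x < r then x + (p - r) else x - (r - q).
pose iota x := if x < q then x else if x < p - r + q then x + (r - q)
               else x - (p - r).
apply: (counts_conj (h := rot_on (p - r + q) q) (rho := rho) (iota := iota)).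
- by move=> x; exact: twist_ltn.
- by move=> x; rewrite /rho; split_ifs; lia.
- by move=> x; rewrite /iota; split_ifs; lia.
- move=> x xp; rewrite /twist tE /t {2}/rho.
  case: (ltnP x q) => xq; last case: (ltnP x r) => xr.
  + case: (ltnP (x + r) p) => xrp.
      by rewrite !rot_on_lt /rho; split_ifs; lia.
    by rewrite !rot_on_wrap /rho; split_ifs; lia.
  + by rewrite rot_on_lt 1?rot_on_out /rho; split_ifs; lia.
  + case: (ltnP (x + q) p) => xrp.
      by rewrite !rot_on_lt /rho; split_ifs; lia.
    by rewrite !rot_on_wrap /rho; split_ifs; lia.
- by move=> y; rewrite /rho /iota; split_ifs; lia.
- by move=> y; rewrite /rho /iota; split_ifs; lia.
- by apply: counts_rot_on; lia.
Qed.

Lemma twist_out p q r s x : r <= x -> twist p q r s x = rot_on p q x.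
Proof. by move=> rx; rewrite /twist (rot_on_out _ rx). Qed.

Lemma rot_on_modq p q x : q %| p -> x < p -> rot_on p q x = x %[mod q].
Proof. by move=> qp xp; rewrite rot_on_ltm // modn_dvdm // modnDr. Qed.

(** From r on only the rotation by q acts, so the point climbs by q; since q divides p, passing p
    brings it to its residue mod q. *)
Lemma twist_climb p q r s x : 0 < q -> q %| p -> r <= x -> x < p ->
  joined (twist p q r s) (x %% q) x.
Proof.
move=> q0 qp; have [n] := ubnP (p - x); elim: n x => // n IH x xn rx xp.
have qlep : q <= p by apply: dvdn_leq => //; lia.
apply: joined_trans (joined_step _ _); rewrite twist_out //.
have e := rot_on_modq qp xp; rewrite -e; case: (ltnP (x + q) p) => xqp.
  by apply: IH; rewrite ?rot_on_lt //; lia.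
rewrite modn_small; first exact: joined_refl.
by rewrite rot_on_wrap; lia.
Qed.

(** Since q divides p, the rotation of {0, ..., p-1} preserves residues mod q. Hence a point first
    enters {0, ..., q-1} at its residue, and there only the rotation by s is seen. *)
Lemma counts_twist_dvdn p q r s : 0 < r -> r <= p -> r <= q -> q %| p ->
  counts (twist p q r s) p (gcdn r s + (q - r)).
Proof.
move=> r0 rp rq qp.
have q0 : 0 < q by lia.
have qlep : q <= p by apply: dvdn_leq => //; lia.
apply: (counts_transfer (h := rot_on r s) (n := q) (rho := modn^~ q) (iota := id)).
- by move=> x; exact: twist_ltn.
- by move=> x; exact: rot_on_ltn.
- by move=> x _; rewrite ltn_mod.
- by move=> x; lia.
- move=> x xp; case: (ltnP x r) => xr; last first.
    by left; rewrite twist_out // rot_on_modq.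
  right; rewrite /twist rot_on_modq //; last exact: rot_on_ltn.
  rewrite (modn_small (_ : x < q)) ?modn_small ?rot_on_ltn //; lia.
- move=> x xq; rewrite /twist rot_on_modq //; last by apply: rot_on_ltn => //; lia.
  by rewrite modn_small // rot_on_ltn.
- by move=> x xq; exact: modn_small.
- move=> x xp; case: (ltnP x r) => xr; last exact: twist_climb.
  by rewrite modn_small; [exact: joined_refl | lia].
- exact: counts_rot_on.
Qed.

Lemma counts_twist_mod p q r s : 0 < r -> r <= p -> r < q -> p %% q = r ->
  counts (twist p q r s) p (gcdn r (s + q)).
Proof.
move=> r0 rp rq pq.
have q0 : 0 < q by lia.
have [m pE] : exists m, p = m * q + r by exists (p %/ q); rewrite -pq -divn_eq.
have qlep : r < p -> q <= p by case: m pE => [|m]; rewrite ?mulSn; lia.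
(* The point below q reached by climbing from x in steps of q and passing p once: as p = r mod q,
   this lowers the residue mod q cyclically by r. *)
pose land x := if x %% q < r then x %% q + q - r else x %% q - r.
have modq x : exists2 n, x = n * q + x %% q & x %% q < q.
  by exists (x %/ q); [exact: divn_eq | rewrite ltn_mod].
have landE x : x < p -> p <= x + q -> x + q - p = land x.
  move=> xp pxq; rewrite /land; have [n xE xq] := modq x.
  case: ltnP => xr.
    (* A point less than p from which one step reaches or passes p has quotient m if its residue is
       below r, and m - 1 otherwise. *)
    have nm : n = m by nia.
    by rewrite nm in xE; lia.
  have nm : m = n.+1 by nia.
  by rewrite nm mulSn in pE; lia.
have landD x : land (x + q) = land x by rewrite /land modnDr.
have Gstep x : r <= x -> x < p -> twist p q r s x = x + q /\ x + q < p \/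
    twist p q r s x = land x /\ land x < q.
  move=> rx xp; rewrite twist_out //; case: (ltnP (x + q) p) => h.
    by left; rewrite rot_on_lt.
  right; rewrite rot_on_wrap //; last lia.
  by rewrite -landE //; split=> //; lia.
have climb x : r <= x -> x < p -> joined (twist p q r s) (land x) x.
  move: {2}(p - x).+1 (ltnSn (p - x)) => n.
  elim: n x => // n IH x xn rx xp.
  apply: joined_trans (joined_step _ _).
  case: (Gstep x rx xp) => [[-> h]|[-> _]]; last exact: joined_refl.
  by rewrite -landD; apply: IH; lia.
(* A landing point in r, ..., q-1 climbs again and loses another r, so {0, ..., r-1} is first
   entered at the residue mod r of the first landing point. *)
pose rho x := if x < r then x else land x %% r.
have small x : x < q -> x < p -> rho x = x %% r.
  move=> xq xp; rewrite /rho; case: ltnP => xr; first by rewrite modn_small.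
  have -> : land x = x - r by rewrite /land modn_small // ifF //; lia.
  by rewrite -{2}(subnK xr) modnDr.
have landp x : r <= x -> x < p -> land x < q /\ land x < p.
  rewrite /land => rx xp; have qp := qlep (leq_ltn_trans rx xp).
  by have := leq_mod x q; have := ltn_pmod x q0; split_ifs; lia.
have Grot x : x < r -> rho (twist p q r s x) = rot_on r (s + q) x.
  move=> xr; rewrite /twist [rot_on r (s + q) x]rot_on_ltm // addnA -modnDml.
  rewrite -[(x + s) %% r]rot_on_ltm //; set z := rot_on r s x.
  have zr : z < r by exact: rot_on_ltn.
  case: (ltnP (z + q) p) => zqp.
    rewrite rot_on_lt // /rho ifF; last lia.
    have -> : land (z + q) = z + q - r by rewrite landD /land modn_small ?zr //; lia.
    by rewrite -{2}(@subnK r (z + q)) ?modnDr //; lia.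
  have pr : p = r by case: m pE => [|m]; rewrite ?mulSn; lia.
  by rewrite /rho pr rot_on_ltm // ltn_mod r0.
rewrite -[gcdn _ _]addn0 -[X in _ + X](subnn r).
apply: (counts_transfer (h := rot_on r (s + q)) (n := r) (rho := rho) (iota := id)).
- by move=> x; exact: twist_ltn.
- by move=> x; exact: rot_on_ltn.
- by move=> x _; rewrite /rho; case: ifP => // _; rewrite ltn_mod.
- by move=> x; lia.
- move=> x xp; case: (ltnP x r) => xr.
    by right; rewrite Grot // /rho xr.
  left; rewrite {2}/rho ifF; last lia.
  have [l1 l2] := landp _ xr xp.
  case: (Gstep x xr xp) => [[-> h]|[-> _]]; last exact: small.
  by rewrite /rho ifF ?landD //; split_ifs; lia.
- exact: Grot.
- by move=> x xr; rewrite /rho xr.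
- have low x : x < q -> x < p -> joined (twist p q r s) (x %% r) x.
    have [n] := ubnP x; elim: n x => // n IH x xn xq xp.
    case: (ltnP x r) => xr; first by rewrite modn_small //; exact: joined_refl.
    apply: joined_trans (climb x xr xp).
    have -> : land x = x - r by rewrite /land modn_small // ifF //; lia.
    by rewrite -{1}(subnK xr) modnDr; apply: IH; lia.
  move=> x xp; rewrite /rho; case: ltnP => xr; first exact: joined_refl.
  apply: joined_trans (climb x xr xp).
  by have [l1 l2] := landp _ xr xp; exact: low.
- by apply: counts_rot_on.
Qed.

(** A point x < r - q moves to x + 2 q and comes back to its residue x, so the return map to {0,
    ..., r-1} fixes it. The q points from r - q on are rotated by 2 q - r; [rho0] lists these first
    and the fixed points after them. *)
Lemma counts_twist_mid p q r : r <= p -> 0 < q -> q <= r -> r <= 2 * q ->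
  q %| p -> counts (twist p q r q) p (gcdn q (2 * q - r) + (r - q)).
Proof.
move=> rp q0 qr r2q qp.
(* Only for p = q or p = 2 q can a step from below r wrap around p. *)
have pE : p = q \/ p = 2 * q \/ 3 * q <= p.
  case/dvdnP: qp rp => -[|[|[|k]]] -> rp; rewrite ?mulSn; lia.
pose rho0 x := if x < r - q then x + q else x - (r - q).
pose iota x := if x < q then x + (r - q) else x - q.
pose rho x := rho0 (if x < r then x else x %% q).
have rhoin x : x < r -> rho x = rho0 x by rewrite /rho => ->.
have rhoout x : r <= x -> rho x = rho0 (x %% q).
  by move=> h; rewrite /rho ltnNge h.
have mq x : x %% q < q by rewrite ltn_mod.
have Gin x : x < r -> rho (twist p q r q x) = rot_on q (2 * q - r) (rho x).
  move=> xr; rewrite (rhoin x) // /twist /rho0; case: ltnP => xrq.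
    rewrite (@rot_on_lt r) //; last lia.
    rewrite [RHS]rot_on_out; last lia.
    case: (ltnP (x + q + q) p) => h.
      rewrite rot_on_lt // rhoout; last lia.
      by rewrite !modnDr modn_small /rho0 ?xrq //; split_ifs; lia.
    have p2 : p = 2 * q by lia.
    by rewrite rot_on_wrap ?rhoin /rho0; split_ifs; lia.
  rewrite (@rot_on_wrap r) //; try lia.
  case: (ltnP p (2 * q)) => p2.
    by rewrite rot_on_wrap ?rhoin /rho0 ?rot_on_wrap; split_ifs; lia.
  rewrite rot_on_lt; last lia.
  case: (ltnP (x + q - r) (r - q)) => h.
    by rewrite rhoin ?rot_on_lt /rho0; split_ifs; lia.
  case: (ltnP r (2 * q)) => r2; last lia.
  rewrite rhoout; last lia.
  rewrite modnDr modn_small; last lia.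
  by rewrite rot_on_wrap /rho0; split_ifs; lia.
apply: (counts_transfer (h := rot_on q (2 * q - r)) (n := r) (rho := rho)
   (iota := iota)).
- by move=> x; exact: twist_ltn.
- by move=> x; exact: rot_on_ltn.
- move=> x xp; rewrite /rho /rho0; have := mq x; split_ifs; lia.
- by move=> x; rewrite /iota; split_ifs; lia.
- move=> x xp; case: (ltnP x r) => xr; first by right; exact: Gin.
  left; rewrite twist_out // [RHS]rhoout //.
  case: (ltnP (x + q) p) => h.
    by rewrite rot_on_lt ?rhoout ?modnDr //; lia.
  rewrite -(rot_on_modq qp xp).
  by rewrite rot_on_wrap ?rhoin ?modn_small //; lia.
- move=> y yr; rewrite Gin; last by rewrite /iota; split_ifs; lia.
  by congr rot_on; rewrite rhoin /rho0 /iota; split_ifs; lia.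
- by move=> y yr; rewrite rhoin /rho0 /iota; split_ifs; lia.
- move=> x xp; have ir y : y < r -> iota (rho0 y) = y.
    by rewrite /iota /rho0; split_ifs; lia.
  case: (ltnP x r) => xr; first by rewrite rhoin // ir //; exact: joined_refl.
  rewrite rhoout // ir; last by have := mq x; lia.
  exact: twist_climb.
- exact: counts_rot_on.
Qed.

(** The return map to {2 q, ..., p-1}, shifted down by 2 q, is again a twist, with p' = p - 2 q and
    r' = r - 2 q. *)
Lemma counts_twist_sub p q r c : r <= p -> 0 < q -> 2 * q < r ->
  counts (twist (p - 2 * q) q (r - 2 * q) q) (p - 2 * q) c ->
  counts (twist p q r q) p c.
Proof.
move=> rp q0 r2q.
have [p' pE] : exists p', p = p' + 2 * q by exists (p - 2 * q); lia.
have [r' rE] : exists r', r = r' + 2 * q by exists (r - 2 * q); lia.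
rewrite {1 2}pE {1}rE !addnK.
have r'0 : 0 < r' by lia.
have r'p' : r' <= p' by lia.
(* First entry, shifted down by 2 q. A point below q loses p' while it can and then jumps by 2 q. A
   point in q, ..., 2 q - 1 first loses r' while it stays at least q, and then continues in the same
   way. *)
pose rho x := if x < q then x %% p' else
  if x < 2 * q then (q + (x - q) %% r') %% p' else x - 2 * q.
have rho1 x : x < q -> rho x = x %% p' by rewrite /rho => ->.
have rho2 x : q <= x -> x < 2 * q -> rho x = (q + (x - q) %% r') %% p'.
  by move=> h1 h2; rewrite /rho ifF ?h2 //; split_ifs; lia.
have rho3 x : 2 * q <= x -> rho x = x - 2 * q.
  by move=> h1; rewrite /rho ifF 1?ifF; split_ifs; lia.
have G1 x : x < r - q -> x < p' -> twist p q r q x = x + 2 * q.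
  by move=> h1 h2; rewrite /twist !rot_on_lt; lia.
have G2 x : x < r - q -> p' <= x -> twist p q r q x = x - p'.
  by move=> h1 h2; rewrite /twist (@rot_on_lt r) 1?rot_on_wrap; lia.
have G3 x : x < r -> r - q <= x -> twist p q r q x = x - r'.
  by move=> h1 h2; rewrite /twist (@rot_on_wrap r) 1?rot_on_lt; lia.
have modsub a b : b <= a -> (a - b) %% b = a %% b.
  by move=> h; rewrite -{2}(subnK h) modnDr.
(* Below 2 q each step either enters the target set or goes strictly down with the same first entry,
   so the descent ends. *)
have low x : x < 2 * q -> rho (twist p q r q x) = rho x /\
    (twist p q r q x = rho x + 2 * q \/ twist p q r q x < x).
  move=> x2q; case: (ltnP x (r - q)) => xrq.
    have rx : rho x = x %% p'.
      case: (ltnP x q) => xq; first exact: rho1.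
      by rewrite rho2 // (@modn_small (x - q)) ?subnKC //; lia.
    case: (ltnP x p') => xp'.
      rewrite G1 // rho3 ?rx ?modn_small ?addnK; by [|lia|split; [|left]].
    by rewrite G2 // rho1 ?rx ?modsub //; [split => //; right|]; lia.
  rewrite G3 //; last lia.
  have [qx qx' qx2] : [/\ q <= x, q <= x - r' & x - r' < 2 * q] by split; lia.
  rewrite !rho2 //.
  have -> : x - r' - q = x - q - r' by lia.
  by rewrite modsub; [split => //; right|]; lia.
have Ghigh x : 2 * q <= x -> x < p ->
    rho (twist p q r q x) = twist p' q r' q (x - 2 * q).
  move=> x2q xp; case: (ltnP x r) => xr; last first.
    rewrite /twist (@rot_on_out r) // (@rot_on_out r'); last lia.
    rewrite [RHS]rot_on_ltm; last lia.
    case: (ltnP (x + q) p) => h.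
      by rewrite rot_on_lt ?rho3 ?modn_small //; lia.
    rewrite rot_on_wrap ?rho1; try lia.
    by rewrite -[RHS]modsub; [congr (_ %% _)|]; lia.
  rewrite {2}/twist [rot_on r' q _]rot_on_ltm; last lia.
  case: (ltnP x (r - q)) => xrq.
    rewrite modn_small ?rot_on_ltm; try lia.
    case: (ltnP x p') => h.
      by rewrite G1 ?rho3 ?modn_small //; lia.
    rewrite G2 ?rho1; try lia.
    by rewrite -[RHS]modsub; [congr (_ %% _)|]; lia.
  rewrite G3 ?rho2; try lia.
  rewrite rot_on_ltm; last by apply: leq_trans r'p'; rewrite ltn_mod.
  have -> : x - r' - q = x - 2 * q + q - r' by lia.
  by rewrite modsub 1?addnC //; lia.
apply: (counts_transfer (rho := rho) (iota := addn^~ (2 * q))).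
- by move=> x; exact: twist_ltn.
- by move=> x; exact: twist_ltn.
- move=> x xp; have p'0 : 0 < p' by lia.
  by rewrite /rho; do 2?[case: ifP => _; first by rewrite ltn_mod]; split_ifs; lia.
- by move=> y; lia.
- move=> x xp; case: (ltnP x (2 * q)) => x2q; first by left; case: (low x x2q).
  by right; rewrite Ghigh // rho3.
- by move=> y yp; rewrite Ghigh ?addnK //; lia.
- by move=> y yp; rewrite rho3 ?addnK //; lia.
- move=> x; have [n] := ubnP x; elim: n x => // n IH x xn xp.
  case: (ltnP x (2 * q)) => x2q; last by rewrite rho3 // subnK //; exact: joined_refl.
  apply: joined_trans (joined_step _ _).
  have [e [->|h]] := low x x2q; first exact: joined_refl.
  by rewrite -e; apply: IH; lia.
Qed.

(** * Cycle counts in the three cases, for s = q and s = -q *)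

Lemma gcdn_eqmod d a b : a = b %[mod d] -> gcdn a d = gcdn b d.
Proof. by move=> e; rewrite -gcdn_modl e gcdn_modl. Qed.

Lemma gcdn_dvdD d a b : d %| a + b -> gcdn a d = gcdn b d.
Proof.
move=> dab; apply/eqP; rewrite eqn_dvd !dvdn_gcd !dvdn_gcdr !andbT.
by rewrite -(dvdn_addr _ (dvdn_gcdl a d)) -(dvdn_addl _ (dvdn_gcdl b d))
  !(dvdn_trans (dvdn_gcdr _ _) dab).
Qed.

(** With truncated subtraction, (q - k) + (k - q) is |q - k|. Lowering p and r by 2 q keeps k, so
    the induction ends at r <= 2 q, where [counts_twist_dvdn] or [counts_twist_mid] applies. *)
Lemma counts_twist_pos_dvdn p q r : 0 < r -> r <= p -> 0 < q -> q %| p ->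
  let k := r %% (2 * q) in
  counts (twist p q r q) p ((q - k) + (k - q) + gcdn k q).
Proof.
move=> + + q0; have [n] := ubnP r; elim: n r p => // n IH r p rn r0 rp qp k.
case: (ltnP (2 * q) r) => [rq|r2q].
  apply: counts_twist_sub => //.
  have -> : k = (r - 2 * q) %% (2 * q) by rewrite /k -{1}(subnK (ltnW rq)) modnDr.
  by apply: IH; rewrite ?dvdn_sub ?dvdn_mull //; lia.
case: (ltngtP r (2 * q)) r2q => // [rlt|re] _.
  have -> : k = r by rewrite /k modn_small.
  case: (leqP r q) => rq.
    rewrite (_ : r - q = 0); last lia.
    by rewrite addn0 addnC; exact: counts_twist_dvdn.
  rewrite (_ : q - r = 0); last lia.
  rewrite add0n addnC (@gcdn_dvdD q r (2 * q - r)).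
    by rewrite gcdnC; apply: counts_twist_mid => //; lia.
  by rewrite addnC subnK ?dvdn_mull // ltnW.
have -> : k = 0 by rewrite /k re modnn.
rewrite subn0 sub0n addn0 gcd0n.
have := @counts_twist_mid p q r rp q0; rewrite re subnn gcdn0.
by rewrite (_ : 2 * q - q = q); [apply => //; lia | lia].
Qed.

(** The induction ends at r = 2 q, where the rotation by q is its own inverse and [counts_twist_opp]
    applies with s = q. *)
Lemma counts_twist_pos_eq0 p q r : 0 < r -> r <= p -> 0 < q ->
  r %% (2 * q) = 0 -> counts (twist p q r q) p (q + gcdn q p).
Proof.
move=> + + q0; have [n] := ubnP r; elim: n r p => // n IH r p rn r0 rp rk.
case: (ltnP (2 * q) r) => [rq|r2q].
  apply: counts_twist_sub => //.
  have -> : gcdn q p = gcdn q (p - 2 * q).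
    have h : 2 * q <= p by lia.
    by rewrite -{1}(subnK h) addnC gcdnMDl.
  apply: IH; try lia.
  by move: rk; rewrite -{1}(subnK (ltnW rq)) modnDr.
have re : r = 2 * q.
  case: (ltngtP r (2 * q)) r2q => // h _; move: rk; rewrite modn_small //; lia.
have := @counts_twist_opp p q r q rp q0; rewrite re.
rewrite (_ : p - 2 * q + q = p - q); last lia.
rewrite (_ : 2 * q - q = q); last lia.
have -> : gcdn (p - q) q = gcdn q p.
  have h : q <= p by lia.
  by rewrite -{2}(subnK h) gcdnDr gcdnC.
by rewrite (addnC (gcdn _ _)) mul2n -addnn dvdnn; apply => //; lia.
Qed.

(** At the end of the induction, either r < 2 q, and being a residue mod q forces r < q, or r = 2 q,
    and then q divides p and q + gcd(q, p) = 2 q. *)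
Lemma counts_twist_pos_mod p q r : 0 < r -> r <= p -> 0 < q ->
  p %% q = r %% (2 * q) -> counts (twist p q r q) p (gcdn r (2 * q)).
Proof.
move=> + + q0; have [n] := ubnP r; elim: n r p => // n IH r p rn r0 rp e.
case: (ltnP (2 * q) r) => [rq|r2q].
  apply: counts_twist_sub => //.
  have h : 2 * q <= p by lia.
  have -> : gcdn r (2 * q) = gcdn (r - 2 * q) (2 * q).
    by rewrite -{1}(subnK (ltnW rq)) gcdnC gcdnDr gcdnC.
  apply: IH; try lia.
  rewrite -[in LHS](modnMDl 2) addnC subnK // e.
  by rewrite -{1}(subnK (ltnW rq)) modnDr.
case: (ltngtP r (2 * q)) r2q => // [rlt|re] _.
  rewrite [in RHS]modn_small // in e.
  have rq : r < q by rewrite -e ltn_mod.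
  by rewrite mul2n -addnn; exact: counts_twist_mod.
have := counts_twist_pos_eq0 r0 rp q0; rewrite re modnn => /(_ erefl).
rewrite re modnn in e; rewrite gcdnn (_ : gcdn q p = q) ?addnn ?mul2n //.
by apply/gcdn_idPl; rewrite /dvdn e.
Qed.

(** Here (r - q) + (q - r) is |r - q|, and s is a natural number standing for -q mod r. Both ranges
    of r give the same gcd because q divides p and r divides s + q. *)
Lemma counts_twist_neg_dvdn p q r s : 0 < r -> r <= p -> 0 < q -> q %| p ->
  r %| s + q ->
  counts (twist p q r s) p ((r - q) + (q - r) + gcdn (r %% (2 * q)) q).
Proof.
move=> r0 rp q0 qp rs.
have -> : gcdn (r %% (2 * q)) q = gcdn r q.
  by apply: gcdn_eqmod; rewrite modn_dvdm ?dvdn_mull.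
case: (leqP q r) => qr.
  rewrite (_ : q - r = 0); last lia.
  rewrite addn0 addnC (@gcdn_dvdD _ r (p - r + q)); first exact: counts_twist_opp.
  by rewrite addnA subnKC // dvdn_add.
rewrite (_ : r - q = 0); last lia.
rewrite add0n addnC gcdnC -(@gcdn_dvdD _ _ _ rs) gcdnC.
by apply: counts_twist_dvdn => //; lia.
Qed.

Lemma counts_twist_neg_eq0 p q r s : 0 < r -> r <= p -> 0 < q ->
  r %% (2 * q) = 0 -> r %| s + q ->
  counts (twist p q r s) p (r - q + gcdn q p).
Proof.
move=> r0 rp q0 /eqP rk rs.
have qr : q %| r by apply: dvdn_trans rk; rewrite dvdn_mull.
rewrite addnC (_ : gcdn q p = gcdn (p - r + q) q).
  by apply: counts_twist_opp => //; exact: dvdn_leq.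
rewrite gcdnC; apply: gcdn_eqmod.
by rewrite modnDr -{1}(subnK rp) -modnDmr (eqP qr) addn0.
Qed.

(** If q <= r, then p = r mod q, so the gcd in [counts_twist_opp] is q and the total is q + (r - q).
    If r < q, the return map of [counts_twist_mod] is the identity on r points. *)
Lemma counts_twist_neg_mod p q r s : 0 < r -> r <= p -> 0 < q ->
  p %% q = r %% (2 * q) -> r %| s + q -> counts (twist p q r s) p r.
Proof.
move=> r0 rp q0 e rs; case: (leqP q r) => qr.
  have pr : p = r %[mod q] by rewrite -[LHS]modn_mod e modn_dvdm // dvdn_mull.
  have rE : gcdn (p - r + q) q + (r - q) = r.
    have /eqP d : (p - r + q) %% q == 0.
      by rewrite modnDr -/(q %| _) -eqn_mod_dvd //; exact/eqP.
    by rewrite -gcdn_modl d gcd0n subnKC.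
  by rewrite -[X in counts _ _ X]rE; exact: counts_twist_opp.
rewrite [in RHS]modn_small // in e; last lia.
by have := @counts_twist_mod p q r s r0 rp qr e; rewrite (gcdn_idPl rs).
Qed.

(** * The permutation of a twisted torus braid *)

Definition braid_end (p : nat) (w : braid_word p) (j : nat) : nat :=
  foldl (fun i g => letter_end g i) j w.

Lemma letter_endK (p : nat) (g : 'I_p.-1 * bool) : involutive (letter_end g).
Proof. by move=> j; rewrite /letter_end; split_ifs; lia. Qed.

Lemma letter_end_ltn (p : nat) (g : 'I_p.-1 * bool) j :
  j < p -> letter_end g j < p.
Proof. by rewrite /letter_end => jp; have := ltn_ord g.1; split_ifs; lia. Qed.

Lemma braid_end_ltn (p : nat) (w : braid_word p) j : j < p -> braid_end w j < p.
Proof.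
by elim: w j => //= g w IH j jp; apply: IH; exact: letter_end_ltn.
Qed.

Lemma braid_end_cat (p : nat) (v w : braid_word p) j :
  braid_end (v ++ w) j = braid_end w (braid_end v j).
Proof. exact: foldl_cat. Qed.

Lemma braid_end_inv (p : nat) (w : braid_word p) :
  cancel (braid_end w) (braid_end (braid_inv w)).
Proof.
elim: w => // g w IH j.
rewrite /braid_inv /= rev_cons -cats1 braid_end_cat -/(braid_inv w).
by rewrite IH; exact: letter_endK.
Qed.

Lemma braid_end_nseq (p : nat) (w : braid_word p) n j :
  braid_end (flatten (nseq n w)) j = iter n (braid_end w) j.
Proof.
by elim: n j => //= n IH j; rewrite braid_end_cat IH -iterSr.
Qed.

(** The successive swaps carry 0 up to k and lower 1, ..., k by one: rotation by -1, written as
    rotation by k mod k + 1. *)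
Lemma foldl_swap_iota k j :
  foldl (fun i n => if i == n then n.+1 else if i == n.+1 then n else i) j
    (iota 0 k) = rot_on k.+1 k j.
Proof.
elim: k => [|k IH]; first by rewrite /rot_on /= modn1; case: j.
rewrite -addn1 iotaD foldl_cat IH /= add0n.
rewrite addn1; case: (ltnP j k.+1) => jk; last first.
  rewrite (@rot_on_out k.+1) //; case: (ltnP j k.+2) => h.
    by rewrite rot_on_wrap; split_ifs; lia.
  by rewrite rot_on_out; split_ifs; lia.
case: (posnP j) => [->|j0]; first by rewrite !rot_on_lt; split_ifs; lia.
by rewrite !rot_on_wrap; split_ifs; lia.
Qed.

Lemma braid_end_sigma_prod p m : 0 < m -> m <= p ->
  braid_end (sigma_prod p m) =1 rot_on m m.-1.
Proof.
move=> m0 mp j; rewrite -[X in rot_on X _](prednK m0) -foldl_swap_iota.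
(* Both lists of indices are strictly increasing and have the same elements. *)
have -> : iota 0 m.-1 = [seq val g.1 | g <- sigma_prod p m].
  rewrite /sigma_prod -map_comp (eq_map (g := val)) //.
  rewrite -(filter_map val (fun i => i < m.-1)).
  rewrite val_enum_ord; apply: (sorted_eq ltn_trans) => //.
- by move=> x y; lia.
- exact: iota_ltn_sorted.
- by apply: sorted_filter; [exact: ltn_trans | exact: iota_ltn_sorted].
- apply: uniq_perm; rewrite ?filter_uniq ?iota_uniq // => x.
  by rewrite mem_filter !mem_iota; lia.
rewrite /braid_end; elim: (sigma_prod p m) j => //= g w IH j; exact: IH.
Qed.

Lemma braid_end_sigma_prod_inv p m : 0 < m -> m <= p ->
  braid_end (braid_inv (sigma_prod p m)) =1 rot_on m 1.
Proof.
move=> m0 mp j; rewrite -[RHS](@braid_end_inv _ (sigma_prod p m)).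
by rewrite braid_end_sigma_prod // rot_on_inv // addn1 prednK.
Qed.

Lemma dvdn_addn_pred m q : 0 < m -> m %| q + q * m.-1.
Proof. by move=> m0; rewrite -mulnS prednK // dvdn_mull. Qed.

(** The braid rotates by -q, written as q (p - 1), on all points, and then likewise on the first r
    points. This is the inverse of [twist], so the cycles agree. *)
Lemma counts_twisted_torus_pos p q r c : 0 < r -> r <= p ->
  counts (twist p q r q) p c ->
  counts (braid_end (twisted_torus_braid p q%:Z r q%:Z)) p c.
Proof.
move=> r0 rp; have p0 : 0 < p by lia.
have E j : braid_end (twisted_torus_braid p q%:Z r q%:Z) j
    = rot_on r (q * r.-1) (rot_on p (q * p.-1) j).
  rewrite braid_end_cat !braid_end_nseq.
  by rewrite !(eq_iter (braid_end_sigma_prod _ _)) // !iter_rot_on.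
apply: (counts_inv (h := twist p q r q)) => // x xp.
- exact: braid_end_ltn.
- exact: twist_ltn.
- by rewrite ?E /twist !rot_on_inv // ?(addnC (q * _)) dvdn_addn_pred.
- by rewrite ?E /twist !rot_on_inv // ?(addnC (q * _)) dvdn_addn_pred.
Qed.

Lemma counts_twisted_torus_neg p q r c : 0 < r -> r <= p -> 0 < q ->
  counts (twist p q r (q * r.-1)) p c ->
  counts (braid_end (twisted_torus_braid p q%:Z r (- q%:Z)%R)) p c.
Proof.
move=> r0 rp q0; have p0 : 0 < p by lia.
have E j : braid_end (twisted_torus_braid p q%:Z r (- q%:Z)%R) j
    = rot_on r q (rot_on p (q * p.-1) j).
  (* For a successor q the exponent -q computes to a [Negz], so [braid_exp] unfolds to powers of the
     inverse word. *)
  case: q q0 => // q _.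
  rewrite braid_end_cat (braid_end_nseq _ q.+1) (braid_end_nseq _ q.+1).
  rewrite (eq_iter (braid_end_sigma_prod_inv _ _)) //.
  by rewrite (eq_iter (braid_end_sigma_prod _ _)) // !iter_rot_on muln1.
apply: (counts_inv (h := twist p q r (q * r.-1))) => // x xp.
- exact: braid_end_ltn.
- exact: twist_ltn.
- by rewrite ?E /twist !rot_on_inv // ?(addnC (q * _)) dvdn_addn_pred.
- by rewrite ?E /twist !rot_on_inv // ?(addnC (q * _)) dvdn_addn_pred.
Qed.

(** * Components of a braid closure *)

Local Open Scope classical_set_scope.
Local Open Scope ring_scope.

Lemma segment_fun_continuous (R : realType) (a b : point3 R) :
  continuous (fun t : R => (1 - t) *: a + t *: b : point3 R).
Proof.
move=> t; apply: cvgD; apply: cvgZr_tmp; last exact: cvg_id.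
by apply: cvgB; [exact: cvg_cst | exact: cvg_id].
Qed.

Lemma connected_segment (R : realType) (a b : point3 R) : connected (segment a b).
Proof.
apply: connected_continuous_connected; first exact: segment_connected.
exact/continuous_subspaceT/segment_fun_continuous.
Qed.

Lemma closed_segment (R : realType) (a b : point3 R) : closed (segment a b).
Proof.
apply: compact_closed; first exact: norm_hausdorff.
apply: continuous_compact; last exact: segment_compact.
exact/continuous_subspaceT/segment_fun_continuous.
Qed.

Lemma segment_fst (R : realType) (a b : point3 R) : segment a b a.
Proof.
by exists 0; rewrite ?subr0 ?scale1r ?scale0r ?addr0 //= in_itv /= lexx ler01.
Qed.

Lemma segment_snd (R : realType) (a b : point3 R) : segment a b b.
Proof.
by exists 1; rewrite ?subrr ?scale1r ?scale0r ?add0r //= in_itv /= lexx ler01.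
Qed.

Lemma closed_polyline (R : realType) (s : seq (point3 R)) : closed (polyline s).
Proof.
elim: s => [|a [|b s] IH] /=; [exact: closed0|exact: closed0|].
by apply: closedU => //; exact: closed_segment.
Qed.

Lemma polyline_head (R : realType) (a b : point3 R) s : polyline [:: a, b & s] a.
Proof. by left; exact: segment_fst. Qed.

Lemma polyline_last (R : realType) (a b : point3 R) s :
  polyline [:: a, b & s] (last b s).
Proof.
elim: s a b => [|c s IH] a b; first by left; exact: segment_snd.
by right; exact: IH.
Qed.

Lemma connected_polyline (R : realType) (s : seq (point3 R)) :
  connected (polyline s).
Proof.
elim: s => [|a [|b [|c s]] IH]; try exact: connected0.
  by rewrite /= setU0; exact: connected_segment.
apply: connectedU; [|exact: connected_segment|exact: IH].
by exists b; split; [exact: segment_snd | exact: polyline_head].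
Qed.

Lemma segmentP (R : realType) (a b c : point3 R) : segment a b c ->
  exists t : R, [/\ 0 <= t <= 1, c.1.1 = (1 - t) * a.1.1 + t * b.1.1,
    c.1.2 = (1 - t) * a.1.2 + t * b.1.2 & c.2 = (1 - t) * a.2 + t * b.2].
Proof. by case=> t; rewrite /= in_itv /= => t01 <-; exists t. Qed.

(* [u] is the height travelled in the slab and [v] the relative distance from
   the plane z = 0. *)
Lemma letter_strandP (R : realType) (p : nat) (g : 'I_p.-1 * bool) n j
    (c : point3 R) : letter_strand g n j c ->
  exists u v : R, [/\ 0 <= u <= 1, 0 <= v <= 1,
    v = 2 * u \/ v = 2 - 2 * u,
    c.1.1 = j%:R + ((letter_end g j)%:R - j%:R) * u &
    c.1.2 = n%:R + u /\ c.2 = letter_height R g j * v].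
Proof.
case=> [|[|//]] /segmentP [t [/= t01 -> -> ->]].
  exists (t / 2), t; split; [lra|lra|left; lra|lra|split; lra].
by exists ((1 + t) / 2), (1 - t); split; [lra|lra|right; lra|lra|split; lra].
Qed.

(** The alternatives are the middle edge at height 2 and the two slanted edges, with z as parameter.
    Strands stay at height at most 1, so only the slanted edges can meet them. *)
Lemma closing_arcP (R : realType) l j (c : point3 R) : closing_arc l j c ->
  c.1.1 = j%:R /\
  [\/ c.2 = 2, 0 <= c.2 /\ c.1.2 = l%:R + c.2 / 2 |
      0 <= c.2 /\ c.1.2 = - (c.2 / 2)].
Proof.
case=> [|[|[|//]]] /segmentP [t [/= t01 -> -> ->]]; split; try lra.
- by apply: Or32; lra.
- by apply: Or31; lra.
- by apply: Or33; lra.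
Qed.

Lemma letter_height_le1 (R : realType) (p : nat) (g : 'I_p.-1 * bool) j :
  -1 <= letter_height R g j <= 1.
Proof. by rewrite /letter_height; split_ifs; lra. Qed.

(* Two strands of the same slab can only meet over the middle of the crossing,
   where one is above and the other below. *)
Lemma letter_strand_inj (R : realType) (p : nat) (g : 'I_p.-1 * bool) n i j
    (c : point3 R) : letter_strand g n i c -> letter_strand g n j c -> i = j.
Proof.
move=> /letter_strandP [u [v [u01 v01 uv xi [yi zi]]]].
move=> /letter_strandP [u' [v' [u01' v01' uv' xj [yj zj]]]].
have uu : u' = u by lra.
subst u'; have vv : v' = v by case: uv => ?; case: uv' => ?; lra.
have vmid : u = 1 / 2 -> v = 1 by move=> ?; case: uv => ?; lra.
subst v'; move: {uv uv'}u01 vmid => u01 vmid; rewrite xi in xj; rewrite zi in zj.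
have natS k : (k.+1%:R : R) = k%:R + 1 by rewrite -natr1.
(* The two crossing strands stay between the positions a and a + 1, while any other strand keeps its
   integer position. *)
have between (a b : nat) : (a%:R : R) <= (b%:R : R) <= a%:R + 1 -> b = a \/ b = a.+1.
  by rewrite natr1 !ler_nat => /andP[h1 h2]; lia.
move: xj zj {yi yj xi zi}; rewrite /letter_end /letter_height; set a : nat := g.1.
case: (eqVneq i a) => [->|ia]; first case: (eqVneq j a) => [->//|ja].
- case: (eqVneq j a.+1) => [->|ja'] xj zj.
    rewrite !natS in xj; have v1 : v = 1 by apply: vmid; lra.
    by rewrite v1 in zj; exfalso; case: (g.2) zj => zj; lra.
  have [] : j = a \/ j = a.+1 by apply: between; rewrite !natS in xj; lra.
  + by move/eqP; rewrite (negbTE ja).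
  + by move/eqP; rewrite (negbTE ja').
- case: (eqVneq i a.+1) => [->|ia']; case: (eqVneq j a) => [->|ja].
  + move=> xj zj; rewrite !natS in xj; have v1 : v = 1 by apply: vmid; lra.
    by rewrite v1 in zj; exfalso; case: (g.2) zj => zj; lra.
  + case: (eqVneq j a.+1) => [->//|ja'] xj zj.
    have [] : j = a \/ j = a.+1 by apply: between; rewrite !natS in xj; lra.
    * by move/eqP; rewrite (negbTE ja).
    * by move/eqP; rewrite (negbTE ja').
  + move=> xj zj.
    have [] : i = a \/ i = a.+1 by apply: between; rewrite !natS in xj; lra.
    * by move/eqP; rewrite (negbTE ia).
    * by move/eqP; rewrite (negbTE ia').
  + case: (eqVneq j a.+1) => [->|ja'] xj zj.
      have [] : i = a \/ i = a.+1 by apply: between; rewrite !natS in xj; lra.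
      * by move/eqP; rewrite (negbTE ia).
      * by move/eqP; rewrite (negbTE ia').
    by apply/eqP; rewrite -(@eqr_nat R); apply/eqP; lra.
Qed.

Lemma connected_component_link (T : topologicalType) (A B : set T) x y :
  connected B -> B `<=` A -> B x -> B y ->
  connected_component A x = connected_component A y.
Proof.
move=> cB BA Bx By; apply: same_connected_component.
exact: (connected_component_max Bx BA cB).
Qed.

(** Finitely many disjoint closed pieces are separated from each other, so a component of A lies in
    one piece; the last hypothesis puts each piece in one component. *)
Lemma num_components_partition (R : realType) (A : set (point3 R)) (c : nat)
    (B : 'I_c -> set (point3 R)) (pt : 'I_c -> point3 R) :
  A = \bigcup_k B k -> (forall k, closed (B k)) ->
  (forall k m x, B k x -> B m x -> k = m) ->
  (forall k, B k (pt k)) ->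
  (forall k x, B k x -> connected_component A x = connected_component A (pt k)) ->
  num_components A = c.
Proof.
move=> AE Bcl Bdis Bpt Bcc; rewrite /num_components.
have BA k : B k `<=` A by rewrite AE; exact: bigcup_sup.
have -> : connected_component A @` A =
    (fun k => connected_component A (pt k)) @` [set: 'I_c].
  rewrite eqEsubset; split=> [_ [x Ax <-]|_ [k _ <-]].
    by move: (Ax); rewrite {1}AE => -[k _ Bkx]; exists k => //; rewrite (Bcc k x).
  by exists (pt k) => //; exact: BA.
apply: card_fset_set.
apply: (@card_eq_trans _ _ _ _ [set: 'I_c]); last by rewrite card_eq_sym card_II.
apply: inj_card_eq => k m _ _ e.
(* The union of the other pieces is closed because it is finite. If the components of [pt k] and
   [pt m] agree, this connected set lies in [B k] or in [C], and the point [pt k] excludes [C]. *)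
pose C := \bigcup_(i in [set i | i != k]) B i.
have Ccl : closed C by apply: closed_bigcup => //; exact: finite_finset.
have dis : B k `&` C = set0.
  rewrite -subset0 => x [Bkx [i /= ik Bix]].
  by rewrite (Bdis _ _ _ Bkx Bix) eqxx in ik.
have sep : separated (B k) C.
  by rewrite /separated -!(closure_id _).1.
have sub : connected_component A (pt k) `<=` B k `|` C.
  move=> x /connected_component_sub; rewrite AE => -[i _ Bix].
  by case: (eqVneq i k) => [<-|ik]; [left | right; exists i].
have ccx i : connected_component A (pt i) (pt i).
  by apply: connected_component_refl; exact: BA (Bpt i).
case: (connected_subset sep sub (@component_connected _ _ _)) => h.
  by apply: (Bdis _ _ (pt m)) => //; apply: h; rewrite e.
have [] : set0 (pt k) by rewrite -dis; split => //; exact: h.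
Qed.

(** * Strands, closing arcs and cycles of the braid permutation *)

Section Closure.
Variables (R : realType) (p : nat) (w : braid_word p).

Let l := size w.
Let strand (n : 'I_l) (j : nat) : set (point3 R) :=
  letter_strand (tnth (in_tuple w) n) n j.
Let A : set (point3 R) := braid_closure w.
Let node (n j : nat) : point3 R := (j%:R, n%:R, 0).

(* the position reached at the top by the strand at position [j] above [n]
   letters *)
Let exit (n j : nat) : nat := braid_end (drop n w) j.

Lemma exit_ltn n j : (j < p)%N -> (exit n j < p)%N.
Proof. exact: braid_end_ltn. Qed.

Lemma exit_step (n : 'I_l) j :
  exit n.+1 (letter_end (tnth (in_tuple w) n) j) = exit n j.
Proof.
(* Only a default letter for [nth] is wanted here. *)
have [g wl] : exists g : 'I_p.-1 * bool, True by exists (tnth (in_tuple w) n).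
by rewrite /exit (drop_nth g (ltn_ord n)) (tnth_nth g).
Qed.

Lemma exit_size j : exit l j = j.
Proof. by rewrite /exit drop_size. Qed.

Lemma exit0 j : exit 0 j = braid_end w j.
Proof. by rewrite /exit drop0. Qed.

Lemma strand_sub n j : (j < p)%N -> strand n j `<=` A.
Proof. by move=> jp x sx; left; exists n => //; exists (Ordinal jp). Qed.

Lemma arc_sub j : (j < p)%N -> closing_arc l j `<=` A.
Proof. by move=> jp x ax; right; exists (Ordinal jp). Qed.

Lemma component_strand (n : 'I_l) j x : (j < p)%N -> strand n j x ->
  connected_component A x = connected_component A (node n j).
Proof.
move=> jp sx; apply: connected_component_link (strand_sub jp) sx _.
  exact: connected_polyline.
exact: polyline_head.
Qed.

Lemma component_arc j x : (j < p)%N -> closing_arc l j x ->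
  connected_component A x = connected_component A (node 0 j).
Proof.
move=> jp ax; apply: connected_component_link (arc_sub jp) ax _.
  exact: connected_polyline.
exact: polyline_last.
Qed.

(** Climb along the strands to the top, by induction on the number of letters left, then return to
    the bottom along the closing arc. *)
Lemma component_node n j : (j < p)%N -> (n <= l)%N ->
  connected_component A (node n j) = connected_component A (node 0 (exit n j)).
Proof.
move=> jp nl; have [m] := ubnP (l - n)%N; elim: m n j jp nl => // m IH n j jp nl lm.
case: (ltngtP n l) nl => // [nl|->] _.
  rewrite -(exit_step (Ordinal nl)) -IH;
    [|exact: letter_end_ltn|exact: nl|rewrite /=; lia].
  apply/esym/(component_strand (n := Ordinal nl) jp).
  by rewrite /node -natr1; exact: polyline_last.
by rewrite exit_size; apply: component_arc => //; exact: polyline_head.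
Qed.

Lemma component_joined i j : (i < p)%N -> (j < p)%N ->
  joined (braid_end w) i j ->
  connected_component A (node 0 i) = connected_component A (node 0 j).
Proof.
have it n k : (k < p)%N -> (iter n (braid_end w) k < p)%N /\
    connected_component A (node 0 (iter n (braid_end w) k)) =
    connected_component A (node 0 k).
  move=> kp; elim: n => //= n [IH1 IH2]; split; first exact: braid_end_ltn.
  by rewrite -exit0 -component_node.
move=> ip jp [n [m e]].
by rewrite -(it n i ip).2 -(it m j jp).2 e.
Qed.

(** In one slab the strands are disjoint. Strands in different slabs can meet only in the plane
    between adjacent slabs, where the upper one starts at the position at which the lower one
    ends. *)
Lemma strand_strand (n m : 'I_l) i j x :
  strand n i x -> strand m j x -> exit n i = exit m j.
Proof.
wlog nm : n m i j / (n <= m)%N.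
  by move=> H s1 s2; case: (leqP n m) => h; [|symmetry]; apply: H => //; exact: ltnW.
rewrite leq_eqVlt in nm; case/orP: nm => [/eqP/val_inj <-|nm] s1 s2.
  by congr exit; exact: letter_strand_inj s1 s2.
have [u [v [u01 _ _ x1 [y1 _]]]] := letter_strandP s1.
have [u' [v' [u01' _ _ x2 [y2 _]]]] := letter_strandP s2.
have nm' : (n.+1%:R : R) <= m%:R by rewrite ler_nat.
rewrite -natr1 in nm'.
have u1 : u = 1 by lra.
have u0 : u' = 0 by lra.
have mE : val m = n.+1.
  by apply/eqP; rewrite -(@eqr_nat R) -natr1; apply/eqP; rewrite /=; lra.
rewrite -exit_step -mE; congr exit.
by apply/eqP; rewrite -(@eqr_nat R); apply/eqP; rewrite u1 in x1; rewrite u0 in x2; lra.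
Qed.

(** They can meet only in the top or the bottom plane of the braid. At the bottom the strand exits
    at [braid_end w i] instead of i, hence the second alternative. *)
Lemma strand_arc (n : 'I_l) i j x : strand n i x -> closing_arc l j x ->
  exit n i = j \/ n = 0%N :> nat /\ i = j.
Proof.
move=> s1 /closing_arcP [x2 H].
have [u [v [u01 v01 _ x1 [y1 z1]]]] := letter_strandP s1.
have hh := letter_height_le1 R (tnth (in_tuple w) n) i.
have zlt : x.2 <= 1 by rewrite z1; nra.
have nl : (n.+1%:R : R) <= l%:R by rewrite ler_nat.
rewrite -natr1 in nl.
have n0 : (0 : R) <= n%:R by exact: ler0n.
case: H => [z2|[z2 y2]|[z2 y2]]; first by exfalso; lra.
  left; have u1 : u = 1 by lra.
  have nE : n.+1 = l.
    by apply/eqP; rewrite -(@eqr_nat R) -natr1; apply/eqP; rewrite /=; lra.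
  rewrite -exit_step nE exit_size.
  by apply/eqP; rewrite -(@eqr_nat R); apply/eqP; rewrite u1 in x1; lra.
right; have u0 : u = 0 by lra.
split; apply/eqP; rewrite -(@eqr_nat R); apply/eqP; first lra.
by rewrite u0 in x1; lra.
Qed.

Lemma arc_arc i j (x : point3 R) : closing_arc l i x -> closing_arc l j x -> i = j.
Proof.
move=> /closing_arcP [x1 _] /closing_arcP [x2 _].
by apply/eqP; rewrite -(@eqr_nat R) -x1 -x2.
Qed.

Lemma num_components_braid_closure c :
  counts (braid_end w) p c -> num_components A = c.
Proof.
move=> [L [Lc Ls Le]].
have Lw j : (j < p)%N -> L (braid_end w j) = L j.
  by move=> jp; apply/Le => //; [exact: braid_end_ltn | exact: joined_step].
(* A strand gets the label of the position where it exits at the top. By [Lw] this is also the label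
   of the closing arc below it. *)
pose B (k : 'I_c) : set (point3 R) :=
  (\bigcup_(n in [set: 'I_l])
     \bigcup_(j in [set j : 'I_p | L (exit n j) = k]) strand n j) `|`
  \bigcup_(j in [set j : 'I_p | L j = k]) closing_arc l j.
have [f fp] : {f : 'I_c -> nat & forall k, (f k < p)%N /\ L (f k) = k}.
  apply: (@boolp.choice 'I_c nat (fun k j => (j < p)%N /\ L j = k)) => k.
  by have [j jp jL] := Ls k (ltn_ord k); exists j.
apply: (num_components_partition (B := B) (pt := fun k => node 0 (f k))).
- rewrite eqEsubset; split=> x.
    move=> [[n _ [j _ sx]]|[j _ ax]].
      exists (Ordinal (Lc _ (exit_ltn n (ltn_ord j)))) => //.
      by left; exists n => //; exists j.
    by exists (Ordinal (Lc _ (ltn_ord j))) => //; right; exists j.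
  move=> [k _ [[n _ [j _ sx]]|[j _ ax]]].
    exact: strand_sub sx.
  exact: arc_sub ax.
- move=> k; apply: closedU; apply: closed_bigcup; try exact: finite_finset.
    move=> n _; apply: closed_bigcup; first exact: finite_finset.
    by move=> j _; exact: closed_polyline.
  by move=> j _; exact: closed_polyline.
- move=> k m x.
  have sa n i j : strand n i x -> closing_arc l j x -> (i < p)%N ->
      L (exit n i) = L j.
    move=> s1 s2 ip; case: (strand_arc s1 s2) => [->//|[n0 <-]].
    by rewrite n0 exit0 Lw.
  move=> [[n _ [i /= ik s1]]|[i /= ik s1]] [[n' _ [j /= jm s2]]|[j /= jm s2]];
    apply/val_inj; rewrite /= -ik -jm.
  + by rewrite (strand_strand s1 s2).
  + exact: sa s1 s2 _.
  + by apply/esym; exact: sa s2 s1 _.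
  + by rewrite (arc_arc s1 s2).
- move=> k; right; exists (Ordinal (fp k).1); first exact: (fp k).2.
  exact: polyline_last.
- move=> k x H.
  have [j [jp Lj ->]] : exists j, [/\ (j < p)%N, L j = k &
      connected_component A x = connected_component A (node 0 j)].
    case: H => [[n _ [i /= ik s1]]|[i /= ik s1]].
      exists (exit n i); split=> //; first exact: exit_ltn.
      by rewrite (component_strand _ s1) // component_node // ltnW.
    by exists i; split=> //; exact: component_arc.
  apply: component_joined => //; first exact: (fp k).1.
  by apply/Le; rewrite ?(fp k).1 ?(fp k).2.
Qed.

End Closure.

Theorem theorem3p6 (R : realType) (p q r : nat)
    (hr : (0 < r)%N) (hrp : (r <= p)%N) (hq : (0 < q)%N) :
  (forall k : nat, (r %% (2 * q))%N = k -> (p %% q)%N = 0%N ->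
     (NC R p q%:Z r q%:Z)%:Z = `|q%:Z - k%:Z| + (gcdn k q)%:Z /\
     (NC R p q%:Z r (- q%:Z))%:Z = `|r%:Z - q%:Z| + (gcdn k q)%:Z)
  /\
  ((r %% (2 * q))%N = 0%N -> (p %% q)%N <> 0%N ->
     (NC R p q%:Z r q%:Z)%:Z = q%:Z + (gcdn q p)%:Z /\
     (NC R p q%:Z r (- q%:Z))%:Z = r%:Z - q%:Z + (gcdn q p)%:Z)
  /\
  ((p %% q)%N = (r %% (2 * q))%N ->
     (NC R p q%:Z r q%:Z)%:Z = (gcdn r (2 * q))%:Z /\
     (NC R p q%:Z r (- q%:Z))%:Z = r%:Z).
Proof.
have pos c : counts (twist p q r q) p c -> NC R p q%:Z r q%:Z = c.
  by move=> h; exact/num_components_braid_closure/counts_twisted_torus_pos.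
have neg c : counts (twist p q r (q * r.-1)) p c -> NC R p q%:Z r (- q%:Z) = c.
  by move=> h; exact/num_components_braid_closure/counts_twisted_torus_neg.
(* This makes q (r - 1) a natural number representing -q mod r. *)
have rs : (r %| q * r.-1 + q)%N by rewrite addnC dvdn_addn_pred.
split=> [k <- /eqP qp|]; [|split=> [rk _|e]]; split.
- by rewrite (pos _ (counts_twist_pos_dvdn hr hrp hq qp)); lia.
- by rewrite (neg _ (counts_twist_neg_dvdn hr hrp hq qp rs)); lia.
- by rewrite (pos _ (counts_twist_pos_eq0 hr hrp hq rk)).
(* With q <= r the truncated difference r - q of the count equals the integer difference of the
   statement. *)
- have qr : (q <= r)%N.
    apply: dvdn_leq => //; apply: (@dvdn_trans (2 * q)); first exact: dvdn_mull.
    exact/eqP.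
  by rewrite (neg _ (counts_twist_neg_eq0 hr hrp hq rk rs)); lia.
- by rewrite (pos _ (counts_twist_pos_mod hr hrp hq e)).
- by rewrite (neg _ (counts_twist_neg_mod hr hrp hq e rs)).
Qed.
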